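(* Let $L\in\mathcal{L}_{\mathbb{R}}[z]\setminus\mathbb{R}$ and let $L=P\circ W$ be a decomposition of $L$ into a composition of rational functions $P,W\in\mathbb{C}(z)$. Then there exists a rational function $v\in\mathbb{C}(z)$ of degree one such that $P\circ v^{-1}\in\mathbb{R}(x)$ and $v\circ W\in\mathcal{L}_{\mathbb{R}}(z)$.
   Context: For a complex rational function $R\in\mathbb{C}(z)$ (in particular for a Laurent polynomial), $\bar R$ denotes the function obtained from $R$ by complex conjugation of all its coefficients. $\mathcal{L}_{\mathbb{R}}[z]$ denotes the ring of complex Laurent polynomials $L\in\mathbb{C}[z,1/z]$ such that $\bar L(1/z)=L(z)$. $\mathcal{L}_{\mathbb{R}}(z)$ denotes the field of rational functions $R\in\mathbb{C}(z)$ such that $\bar R(1/z)=R(z)$. (These are the images of the ring $\mathbb{R}_t[\theta]$ generated over $\mathbb{R}$ by $\cos\theta,\sin\theta$, and of its quotient field, under $\cos\theta\mapsto\frac{z+1/z}{2}$, $\sin\theta\mapsto\frac{z-1/z}{2i}$.) $\mathbb{R}(x)$ denotes the rational functions with real coefficients, the name of the variable being immaterial. The symbol $\circ$ denotes composition of functions, and $v^{-1}$ is the compositional inverse of the degree one function $v$. *)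

(* Defs.v *)
From mathcomp Require Import all_boot all_order all_algebra.
From mathcomp Require Import complex.
From mathcomp Require Import reals.

Set Implicit Arguments.
Unset Strict Implicit.
Unset Printing Implicit Defensive.

Import GRing.Theory Num.Theory.
Local Open Scope ring_scope.

Notation "x %:F" := (@tofrac _ x) : ring_scope.

Section RationalFunctions.
Variable K : fieldType.
Implicit Types F G : {fraction {poly K}}.

(* [\n_(repr F)] and [\d_(repr F)] come from an arbitrary representative, which
   need not be in lowest terms; the common factor is divided out. *)
Definition rnum F : {poly K} :=
  \n_(repr F) %/ gcdp \n_(repr F) \d_(repr F).
Definition rden F : {poly K} :=
  \d_(repr F) %/ gcdp \n_(repr F) \d_(repr F).

Definition rdeg F : nat := maxn (size (rnum F)).-1 (size (rden F)).-1.

Definition rconst (c : K) : {fraction {poly K}} := (c%:P)%:F.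
Definition rvar : {fraction {poly K}} := ('X : {poly K})%:F.

Definition rsubst (p : {poly K}) G : {fraction {poly K}} :=
  (map_poly rconst p).[G].

(* The composition F \o G.  The only case in which it is meaningless is G
   constant, equal to a pole of F; the value is then 0. *)
Definition rcomp F G : {fraction {poly K}} :=
  rsubst (rnum F) G / rsubst (rden F) G.

Definition is_comp_inverse F G : Prop :=
  rcomp F G = rvar /\ rcomp G F = rvar.

Definition is_laurent F : Prop :=
  exists (p : {poly K}) (n : nat), F = p%:F / rvar ^+ n.

End RationalFunctions.

Arguments rvar {K}.

Section RealStructure.
Variable R : realType.
Implicit Type F : {fraction {poly R[i]}}.

Definition rbar F : {fraction {poly R[i]}} :=
  (map_poly (@conjc R) (rnum F))%:F / (map_poly (@conjc R) (rden F))%:F.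

Definition in_LR_field F : Prop := rcomp (rbar F) rvar^-1 = F.

Definition in_LR_ring F : Prop := is_laurent F /\ in_LR_field F.

Definition in_real_ratfun F : Prop :=
  exists p q : {poly R}, q != 0 /\
    F = (map_poly (real_complex R) p)%:F / (map_poly (real_complex R) q)%:F.

Definition is_real_const F : Prop :=
  exists c : R, F = rconst (real_complex R c).

End RealStructure.

(* Main.v *)
From HB Require Import structures.
Require Import Defs.
From mathcomp Require Import all_boot all_order all_algebra.
From mathcomp Require Import complex reals ring zify.

Set Implicit Arguments.
Unset Strict Implicit.
Unset Printing Implicit Defensive.

Import GRing.Theory Num.Theory.
Local Open Scope ring_scope.

(* Let sigma be the antilinear involution F(z) |-> Fbar(1/z) of C(z).  It is
   enough to find a Moebius transformation v with sigma (v o W) = v o W: then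
   Q = P o v^-1 satisfies Q o V = L = Qbar o V for V = v o W, so Q = Qbar.
   Composing W with a Moebius transformation, we may put a pole of P at infinity;
   W is then integral over the Laurent polynomials, hence one of them.
   - If P = a / b has another pole d, then W - d is a unit c z^j, and the Cayley
     transform i (1 - Z) / (1 + Z) of Z = z^j is fixed by sigma.
   - If P is a polynomial of degree n, normalise it so that its coefficient of
     degree n - 1 vanishes, and let U = sigma W.  Comparing P(W) = Pbar(U) at
     infinity gives r with W - r U of negative degree and |r| = 1.  Then
     sigma (W - r U) = - rbar (W - r U), so W - r U also vanishes at 0, whence
     W = r U, and W is a constant multiple of a sigma-invariant function. *)

(** * Fractions and their morphisms *)

Section Fractions.
Variable K : fieldType.
Implicit Types (p q : {poly K}) (F G W : {fraction {poly K}}).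

Lemma frac_repr F : F = (\n_(repr F))%:F / (\d_(repr F))%:F.
Proof.
have d0 : (\d_(repr F))%:F != 0 by rewrite tofrac_eq0 denom_ratioP.
apply: (mulIf d0); rewrite mulfVK // -{1}[F]reprK.
rewrite !piE; apply/eqmodP => /=; rewrite FracField.equivfE.
rewrite /FracField.mulf !numden_Ratio ?oner_eq0 ?mulr1 ?mulf_neq0 ?denom_ratioP ?oner_eq0 //.
by rewrite mulrC.
Qed.

Lemma rden_neq0 F : rden F != 0.
Proof.
rewrite /rden divp_eq0 negb_or denom_ratioP /= negb_or; apply/andP; split.
  by rewrite gcdp_eq0 negb_and denom_ratioP orbT.
by rewrite -leqNgt dvdp_leq ?denom_ratioP ?dvdp_gcdr.
Qed.

Lemma coprimep_rnum_rden F : coprimep (rnum F) (rden F).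
Proof. by apply: coprimep_div_gcd; rewrite denom_ratioP orbT. Qed.

Lemma fracE F : F = (rnum F)%:F / (rden F)%:F.
Proof.
have d0 := denom_ratioP (repr F).
have g0 : gcdp \n_(repr F) \d_(repr F) != 0 by rewrite gcdp_eq0 negb_and d0 orbT.
rewrite {1}[F]frac_repr -{1}(divpK (dvdp_gcdl \n_(repr F) \d_(repr F))).
rewrite -{3}(divpK (dvdp_gcdr \n_(repr F) \d_(repr F))) !tofracM.
by rewrite -mulf_div divff ?mulr1 // tofrac_eq0.
Qed.

(** Two coprime representations of one fraction have associate numerators and associate
    denominators: Gauss's lemma applied to the cross-multiplied equality. Hence the arbitrary
    representative behind [rdeg] does not matter. *)
Lemma rdeg_coprime p q : q != 0 -> coprimep p q ->
  rdeg (p%:F / q%:F) = maxn (size p).-1 (size q).-1.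
Proof.
move=> q0 cpq; set F := _ / _.
have d0 := rden_neq0 F.
have E : rnum F * q = p * rden F.
  apply/eqP; rewrite -tofrac_eq !tofracM.
  by rewrite -eqr_div ?tofrac_eq0 // -fracE.
have cF := coprimep_rnum_rden F.
have /eqp_size sn : rnum F %= p.
  rewrite /eqp -(Gauss_dvdpl _ cF) -E dvdp_mulr //=.
  by rewrite -(Gauss_dvdpl _ cpq) E dvdp_mulr.
rewrite coprimep_sym in cF; rewrite coprimep_sym in cpq.
have /eqp_size sd : rden F %= q.
  rewrite /eqp -(Gauss_dvdpr _ cF) E dvdp_mull //=.
  by rewrite -(Gauss_dvdpr _ cpq) -E dvdp_mull.
by rewrite /rdeg sn sd.
Qed.

End Fractions.

Section FractionMorphism.
Variables (K : fieldType) (L : fieldType) (phi : {rmorphism {poly K} -> L}).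
Hypothesis phi_neq0 : forall p : {poly K}, p != 0 -> phi p != 0.

(** The proof of non-vanishing is an argument so that the term itself carries what its ring morphism
    structure needs. *)
Definition frac_map of (forall p : {poly K}, p != 0 -> phi p != 0) := fun F => phi (rnum F) / phi (rden F).
Local Notation Phi := (frac_map phi_neq0).

Lemma frac_map_frac (p q : {poly K}) : q != 0 -> Phi (p%:F / q%:F) = phi p / phi q.
Proof.
move=> q0; rewrite /frac_map; set F := p%:F / q%:F.
have d0 := rden_neq0 F.
have E : rnum F * q = p * rden F.
  apply/eqP; rewrite -tofrac_eq !tofracM.
  by rewrite -eqr_div ?tofrac_eq0 // -fracE.
by apply/eqP; rewrite eqr_div ?phi_neq0 // -!rmorphM E.
Qed.

Lemma frac_map_tofrac (p : {poly K}) : Phi p%:F = phi p.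
Proof.
by rewrite -[p%:F]divr1 -tofrac1 frac_map_frac ?oner_eq0 // rmorph1 divr1.
Qed.

Lemma frac_map_is_zmod_morphism : zmod_morphism Phi.
Proof.
move=> F G; have [f0 g0] := (rden_neq0 F, rden_neq0 G).
rewrite {1}[F]fracE {1}[G]fracE -mulNr addf_div ?tofrac_eq0 //.
rewrite -tofracN -!tofracM -tofracD frac_map_frac ?mulf_neq0 //.
by rewrite rmorphD !rmorphM rmorphN /frac_map -mulNr addf_div ?phi_neq0.
Qed.

Lemma frac_map_is_monoid_morphism : monoid_morphism Phi.
Proof.
split; first by rewrite -tofrac1 frac_map_tofrac rmorph1.
move=> F G; have [f0 g0] := (rden_neq0 F, rden_neq0 G).
rewrite {1}[F]fracE {1}[G]fracE mulf_div -!tofracM frac_map_frac ?mulf_neq0 //.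
by rewrite !rmorphM -mulf_div.
Qed.

HB.instance Definition _ := GRing.isZmodMorphism.Build _ _ Phi
  frac_map_is_zmod_morphism.
HB.instance Definition _ := GRing.isMonoidMorphism.Build _ _ Phi
  frac_map_is_monoid_morphism.

End FractionMorphism.

(** * Laurent polynomials *)

(* [K] and [ev] stand for [{fraction {poly C}}] and [tofrac]: on an abstract [K]
   rewriting and [field] do not unfold the quotient. *)
Section Homogenization.
Variables (C K : fieldType) (ev : {rmorphism {poly C} -> K}).
Implicit Types (a b p q : {poly C}).
Hypothesis ev_neq0 : forall p, p != 0 -> ev p != 0.

Lemma ev_inj : injective ev.
Proof.
move=> p q E; apply/eqP; rewrite -subr_eq0.
by apply: contra_eqT E => /ev_neq0; rewrite rmorphB subr_eq0.
Qed.

Definition scalar := ev \o polyC.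
HB.instance Definition _ := GRing.RMorphism.on scalar.

Definition eval_at W a := (map_poly scalar a).[W].
HB.instance Definition _ W := GRing.RMorphism.copy (eval_at W)
  (horner_eval W \o map_poly scalar).

Lemma eval_atC W c : eval_at W c%:P = scalar c.
Proof. by rewrite /eval_at map_polyC hornerC. Qed.

Lemma eval_atX W : eval_at W 'X = W.
Proof. by rewrite /eval_at map_polyX hornerX. Qed.

Lemma eval_at_comp W a b : eval_at W (a \Po b) = eval_at (eval_at W b) a.
Proof. by rewrite /eval_at map_comp_poly horner_comp. Qed.

Lemma eval_at_wide W a n : (size a <= n)%N -> eval_at W a = \sum_(i < n) scalar a`_i * W ^+ i.
Proof.
move=> sa; rewrite /eval_at (horner_coef_wide (n := n)); last exact: leq_trans (size_poly _ _) sa.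
by apply: eq_bigr => i _; rewrite coef_map.
Qed.

(* [q ^+ n] times the value of [a] at [p / q] *)
Definition homog n a p q := \sum_(i < n.+1) a`_i *: (p ^+ i * q ^+ (n - i)).

Lemma ev_scale c p : ev (c *: p) = scalar c * ev p.
Proof. by rewrite -mul_polyC rmorphM. Qed.

Lemma ev_homog n a p q : (size a <= n.+1)%N -> q != 0 ->
  ev (homog n a p q) = ev q ^+ n * eval_at (ev p / ev q) a.
Proof.
move=> sa q0; rewrite (eval_at_wide _ sa) rmorph_sum mulr_sumr; apply: eq_bigr => i _ /=.
rewrite ev_scale rmorphM !rmorphXn /= expr_div_n.
have -> : ev q ^+ n = ev q ^+ (n - i) * ev q ^+ i by rewrite -exprD subnK // -ltnS.
have := expf_neq0 i (ev_neq0 q0).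
by move: (ev q ^+ i) (ev q ^+ (n - i)) => x y x0; field.
Qed.

Lemma homog_rem n a p q : exists r, homog n a p q = a`_n *: p ^+ n + q * r.
Proof.
exists (\sum_(i < n) a`_i *: (p ^+ i * q ^+ (n - i).-1)).
rewrite /homog big_ord_recr /= subnn mulr1 addrC; congr (_ + _).
rewrite mulr_sumr; apply: eq_bigr => i _; rewrite -scalerAr mulrCA -exprS prednK //.
by rewrite subn_gt0.
Qed.

Local Notation z := (ev 'X).

Definition laurent W := exists p k, W = ev p / z ^+ k.

Lemma var_neq0 : z != 0.
Proof. by rewrite ev_neq0 // polyX_eq0. Qed.

Lemma laurent_common W U : laurent W -> laurent U ->
  exists p q k, W = ev p / z ^+ k /\ U = ev q / z ^+ k.
Proof.
have z0 := var_neq0.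
move=> [p [k ->]] [q [l ->]]; exists (p * 'X^l), (q * 'X^k), (k + l)%N.
rewrite !rmorphM !rmorphXn /= exprD.
have := expf_neq0 k z0; have := expf_neq0 l z0.
by move: (z ^+ k) (z ^+ l) => x y x0 y0; split; field; rewrite x0 y0.
Qed.

Lemma laurentD W U : laurent W -> laurent U -> laurent (W + U).
Proof.
move=> lW lU; have [p [q [k [-> ->]]]] := laurent_common lW lU.
by exists (p + q), k; rewrite rmorphD mulrDl.
Qed.

Lemma laurentM W U : laurent W -> laurent U -> laurent (W * U).
Proof.
move=> [p [k ->]] [q [l ->]].
by exists (p * q), (k + l)%N; rewrite rmorphM exprD mulf_div.
Qed.

Lemma laurent_ev p : laurent (ev p).
Proof. by exists p, 0%N; rewrite expr0 divr1. Qed.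

Lemma laurent_at W a : laurent W -> laurent (eval_at W a).
Proof.
move=> lW; elim/poly_ind: a => [|a c IH].
  by rewrite rmorph0 -(rmorph0 ev); apply: laurent_ev.
rewrite rmorphD rmorphM /= eval_atX eval_atC; apply: laurentD; last exact: laurent_ev.
exact: laurentM.
Qed.

Lemma dvdp_Xn p k : p %| 'X^k -> exists2 c, c != 0 & exists j, p = c *: 'X^j.
Proof.
rewrite -['X]subr0 -polyC0 => /dvdp_exp_XsubCP[j _ /eqpP[[c d] /= /andP[c0 d0]]].
rewrite subr0 => E.
exists (c^-1 * d); first by rewrite mulf_neq0 ?invr_neq0.
by exists j; rewrite -scalerA -E scalerA mulVf // scale1r.
Qed.

Hypothesis ev_frac : forall W, exists p q, [/\ q != 0, coprimep p q & W = ev p / ev q].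

(* A pole of [a / b] at infinity makes [W] integral over the Laurent
   polynomials, which are integrally closed. *)
Lemma laurent_integral L W a b : laurent L -> (size b < size a)%N ->
  eval_at W a = L * eval_at W b -> laurent W.
Proof.
have z0 := var_neq0.
move=> [l [k ->]] sba E; have [p [q [q0 cpq WE]]] := ev_frac W.
have sa0 : (0 < size a)%N by exact: leq_ltn_trans sba.
pose n := (size a).-1; have sa : size a = n.+1 by rewrite prednK.
have H : 'X^k * homog n a p q = l * homog n b p q.
  apply: ev_inj; rewrite !rmorphM rmorphXn /= !ev_homog ?sa //; last by rewrite -sa ltnW.
  rewrite -WE E; set x := z ^+ k; have x0 : x != 0 by exact: expf_neq0.
  by field.
have [r1 H1] := homog_rem n a p q; have [r2 H2] := homog_rem n b p q.
have bn : b`_n = 0 by rewrite nth_default // -ltnS -sa.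
move: H; rewrite H1 H2 bn scale0r add0r mulrDr => /(canRL (addrK _)) H.
(* Modulo [q] only the term in [p ^+ n] survives, and it is absent on the side of [b] since
   [size b < size a]. By coprimality [q] then divides ['X^k]. *)
have : q %| 'X^k * (a`_n *: p ^+ n).
  by rewrite H dvdp_sub // ?(mulrCA l) ?(mulrCA 'X^k) dvdp_mulr.
have lc0 : a`_n != 0 by rewrite -[a`_n]/(lead_coef a) lead_coef_eq0 -size_poly_gt0.
have cqp : coprimep q (p ^+ n) by rewrite coprimep_sym coprimep_expl.
rewrite -scalerAr (dvdpZr _ _ lc0) (Gauss_dvdpl _ cqp).
case/dvdp_Xn => c c0 [j qE]; exists (c^-1 *: p), j.
rewrite WE qE !ev_scale rmorphXn /= [scalar c^-1]fmorphV.
by field; rewrite fmorph_eq0 c0 expf_neq0.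
Qed.

Lemma laurent_unit W U : laurent W -> laurent U -> W * U = 1 ->
  exists2 c, c != 0 & exists i j, W = scalar c * z ^+ i / z ^+ j.
Proof.
have z0 := var_neq0.
move=> [p [k ->]] [q [l ->]]; rewrite mulf_div -exprD -rmorphM -rmorphXn.
move/divr1_eq/ev_inj => E.
have /dvdp_Xn[c c0 [i ->]] : p %| 'X^(k + l) by rewrite -E dvdp_mulr.
by exists c => //; exists i, k; rewrite ev_scale rmorphXn.
Qed.

End Homogenization.

Section NonConstant.
Variables (C : closedFieldType) (K : fieldType) (ev : {rmorphism {poly C} -> K}).

(** The polynomial splits into linear factors, and each takes a value [W - c], which is nonzero. So
    fractions can be evaluated at [W]. *)
Lemma eval_at_neq0 W : (forall c, W != scalar ev c) -> forall p : {poly C}, p != 0 -> eval_at ev W p != 0.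
Proof.
move=> ncW p p0; have [r ->] := closed_field_poly_normal p.
rewrite -mul_polyC rmorphM /= eval_atC.
apply: mulf_neq0; first by rewrite fmorph_eq0 lead_coef_eq0.
rewrite rmorph_prod /=; elim/big_rec: _ => [|x y _]; first exact: oner_neq0.
by apply: mulf_neq0; rewrite rmorphB /= eval_atX eval_atC subr_eq0 ncW.
Qed.

End NonConstant.

(** * Comparison of leading terms at infinity *)

Section LeadingTerms.
Variable C : numClosedFieldType.
Implicit Types (p u Q : {poly C}).

Lemma coef_mul_top p u m n : (size p <= m.+1)%N -> (size u <= n.+1)%N ->
  (p * u)`_(m + n) = p`_m * u`_n.
Proof.
move=> sp su; rewrite coefM.
have lt_m : (m < (m + n).+1)%N by rewrite ltnS leq_addr.
rewrite (bigD1 (Ordinal lt_m)) //= addKn big1 ?addr0 // => i.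
rewrite -val_eqE /= neq_ltn => /orP[im|im]; last by rewrite [p`_i]nth_default ?mul0r // (leq_trans sp).
by rewrite [u`__]nth_default ?mulr0 // (leq_trans su) //; lia.
Qed.

Lemma size_exp_le p m n : (size p <= m.+1)%N -> (size (p ^+ n)%R <= (n * m).+1)%N.
Proof.
move=> sp; apply: leq_trans (size_poly_exp_leq p n) _.
by rewrite ltnS mulnC leq_mul2l; apply/orP; right; lia.
Qed.

Lemma coef_exp_top p m n : (size p <= m.+1)%N -> (p ^+ n)`_(n * m) = p`_m ^+ n.
Proof.
move=> sp; elim: n => [|n IH]; first by rewrite !expr0 mul0n coefC.
by rewrite mulSn !exprS coef_mul_top ?IH //; apply: size_exp_le.
Qed.

(** The term of index [i] has degree at most [i (k + m) + (n - i) k = n (k + m) - (n - i) m], and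
    only indices [i <= n - 2] contribute. *)
Lemma size_homog n Q p k m : (size Q <= n.-1)%N -> (size p <= (k + m).+1)%N ->
  (size (homog n Q p 'X^k) <= (n * (k + m)).+1 - 2 * m)%N.
Proof.
move=> sQ sp; apply: leq_trans (size_sum _ _ _) _; apply/bigmax_leqP => -[i /= lt_in] _.
have [lt_i|le_i] := ltnP i n.-1; last first.
  by rewrite nth_default ?scale0r ?size_poly0 // (leq_trans sQ).
apply: leq_trans (size_scale_leq _ _) _; rewrite -exprM.
have := size_exp_le i sp; have [->|pi0] := eqVneq (p ^+ i) 0.
  by rewrite mul0r size_poly0.
rewrite size_mulXn // => H.
rewrite (leq_trans (leq_add (leqnn _) H)) //.
have [d ->] : exists d, n = (i + d.+2)%N by exists (n - i).-2; lia.
by rewrite addKn; nia.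
Qed.

(* With [r] the ratio of the leading coefficients,
   [c p^n - c' u^n = c (p - r u) S], where the degree of [S] is exactly
   [(n - 1) deg p]. *)
Lemma leading_ratio (n k m : nat) (c c' : C) p u : (0 < n)%N -> (0 < m)%N ->
    c != 0 -> c' != 0 -> size p = (k + m).+1 -> (size u <= (k + m).+1)%N ->
    (size (c *: p ^+ n - c' *: u ^+ n)%R <= (n * (k + m)).+1 - 2 * m)%N ->
  exists2 r, r ^+ n = c' / c & (size (p - r *: u)%R <= k)%N.
Proof.
set N := (k + m)%N => n0 m0 c0 c'0 sp su se.
have pN : p`_N != 0.
  by rewrite -[N]/(N.+1.-1) -sp -[p`__]/(lead_coef p) lead_coef_eq0 -size_poly_gt0 sp.
have E : c * p`_N ^+ n = c' * u`_N ^+ n.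
  apply/eqP; rewrite -subr_eq0 -!coef_exp_top ?sp // -!coefZ -coefB.
  by rewrite nth_default //; apply: leq_trans se _; lia.
have uN : u`_N != 0.
  apply: contraNneq pN => uN; move/eqP: E; rewrite uN expr0n -[n]prednK //= mulr0.
  by rewrite mulf_eq0 (negPf c0) expf_eq0.
have uN' : u`_N ^+ n != 0 by rewrite expf_neq0.
pose r := p`_N / u`_N.
have rn : r ^+ n = c' / c.
  by rewrite expr_div_n; apply/eqP; rewrite eqr_div // mulrC E.
exists r => //; set d := p - _.
pose S := \sum_(i < n) p ^+ (n.-1 - i) * (r *: u) ^+ i.
have dS : c *: p ^+ n - c' *: u ^+ n = c *: (d * S).
  by rewrite -subrXX exprZn rn scalerBr scalerA mulrCA divff ?mulr1.
have [->|d0] := eqVneq d 0; first by rewrite size_poly0.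
have sru : (size (r *: u)%R <= N.+1)%N by apply: leq_trans (size_scale_leq _ _) _.
have SN : S`_(n.-1 * N) != 0.
  (* As [r *: u] and [p] have the same coefficient of degree [N], all [n] summands share their top
     coefficient, and [n] is nonzero in characteristic 0. *)
  rewrite coef_sum (eq_bigr (fun=> p`_N ^+ n.-1)); last first.
    move=> i _; have lt_in := ltn_ord i; have -> : (n.-1 * N = (n.-1 - i) * N + i * N)%N by nia.
    rewrite coef_mul_top ?size_exp_le ?sp // !coef_exp_top ?sp // coefZ divfK //.
    by rewrite -exprD; congr (_ ^+ _); lia.
  by rewrite sumr_const card_ord -mulr_natl mulf_neq0 ?expf_neq0 // pnatr_eq0 -lt0n.
have S0 : S != 0 by apply: contraNneq SN => ->; rewrite coef0.
have sS : (n.-1 * N < size S)%N.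
  by rewrite ltnNge; apply: contra SN => ?; rewrite nth_default.
(* Degrees add: [deg d + (n - 1) N <= n N - 2 m], so [deg d <= k - m < k]. *)
move: se; rewrite dS size_scale // size_mul //.
have := size_poly_gt0 d; rewrite d0 -/N => sd.
have -> : (n * N = N + n.-1 * N)%N by rewrite -mulSn prednK.
move: (size d) (size S) (n.-1 * N)%N sd sS => x y w; rewrite /N.
by clear -m0; lia.
Qed.

End LeadingTerms.

(** * Laurent polynomials and their reflections *)

Section Reversal.
Variable C : numClosedFieldType.
Implicit Types (p u Q : {poly C}).
Local Notation conj_poly := (map_poly (@Num.conj C)).

(* [p / 'X^k] reflects to [rev_conj k p / 'X^k] when [size p <= k.*2.+1]. *)
Definition rev_conj k p := \poly_(i < k.*2.+1) (p`_(k.*2 - i))^*.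

Lemma size_rev_conj k p : (size (rev_conj k p) <= k.*2.+1)%N.
Proof. exact: size_poly. Qed.

Lemma rev_conjK k p : (size p <= k.*2.+1)%N -> rev_conj k (rev_conj k p) = p.
Proof.
move=> sp; apply/polyP => i; rewrite !coef_poly; case: ltnP => [ik|ki].
  by rewrite ltnS leq_subr subKn ?conjCK.
by rewrite nth_default // (leq_trans sp).
Qed.

(* A Laurent polynomial of negative degree at infinity that is proportional to
   its reflection has no pole at 0 either, and vanishes there. *)
Lemma rev_conj_fixed_small k p r : (size p <= k)%N ->
  rev_conj k p = r *: p -> p = 0.
Proof.
move=> sp E; apply/polyP => i; rewrite coef0.
have [ik|ki] := ltnP i k; last by rewrite nth_default // (leq_trans sp).
move/polyP/(_ (k.*2 - i)%N): E; rewrite coef_poly coefZ ltnS leq_subr.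
rewrite subKn ?[X in _ * X]nth_default ?mulr0; [|by apply: leq_trans sp _; lia|lia].
by move/eqP; rewrite conjC_eq0 => /eqP.
Qed.

(** The first bound says that [p / 'X^k] has no pole at infinity, the second, read through the
    reflection, that it has none at 0. *)
Lemma rev_conj_const k p : (size p <= k.+1)%N -> (size (rev_conj k p) <= k.+1)%N ->
  p = p`_k *: 'X^k.
Proof.
move=> sp su; apply/polyP => i; rewrite coefZ coefXn.
have [->|ne] := eqVneq i k; first by rewrite mulr1.
rewrite mulr0; have [ik|ki] := ltnP i k.
  have : (rev_conj k p)`_(k.*2 - i) = 0 by rewrite nth_default //; apply: leq_trans su _; lia.
  rewrite coef_poly ltnS leq_subr subKn; last by lia.
  by move/eqP; rewrite conjC_eq0 => /eqP.
by rewrite nth_default // (leq_trans sp) // ltn_neqAle eq_sym ne.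
Qed.

(** The normalisation of [Q] enters here: the remainder has degree at most [n - 2], which yields the
    gap of [2 * m] in [size_homog]. *)
Lemma homog_lead_split n Q p q : size Q = n.+1 -> Q`_n.-1 = 0 -> (0 < n)%N ->
  homog n Q p q = Q`_n *: p ^+ n + homog n (Q - Q`_n *: 'X^n) p q /\
  (size (Q - Q`_n *: 'X^n)%R <= n.-1)%N.
Proof.
move=> sQ Qn n0; split.
  rewrite /homog [in LHS]big_ord_recr [in RHS]big_ord_recr /= subnn !mulr1.
  rewrite coefB coefZ coefXn eqxx mulr1 subrr scale0r addr0 addrC; congr (_ + _).
  apply: eq_bigr => i _; rewrite coefB coefZ coefXn.
  by rewrite ltn_eqF // mulr0 subr0.
apply/leq_sizeP => i ni; rewrite coefB coefZ coefXn.
have [->|/eqP ne] := eqVneq i n; first by rewrite mulr1 subrr.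
rewrite mulr0 subr0; have [->//|ne'] := eqVneq i n.-1.
by rewrite nth_default // sQ; lia.
Qed.

(** [r * r^*] is a nonnegative real whose [n]-th power is 1, because [c^* / c] is inverse to its own
    conjugate. *)
Lemma conj_norm1 (r c : C) n : (0 < n)%N -> c != 0 -> r ^+ n = c^* / c -> r * r^* = 1.
Proof.
move=> n0 c0 E; apply/eqP; rewrite -(@pexpr_eq1 _ _ n) ?mul_conjC_ge0 //.
rewrite exprMn -rmorphXn /= E fmorph_div /= conjCK.
by rewrite mulrA divfK // divff // conjC_eq0.
Qed.

(** The case where [p / 'X^k] has a pole at infinity, of order at least that of its reflection.
    [leading_ratio] gives [r] with proportionality up to negative degree, and [rev_conj_fixed_small]
    makes it exact. *)
Lemma rev_conj_proportional_aux n k Q p : (0 < n)%N -> size Q = n.+1 -> Q`_n.-1 = 0 ->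
    (size p <= k.*2.+1)%N -> (k.+1 < size p)%N ->
    (size (rev_conj k p) <= size p)%N ->
    homog n Q p 'X^k = homog n (conj_poly Q) (rev_conj k p) 'X^k ->
  exists2 r, r * r^* = 1 & p = r *: rev_conj k p.
Proof.
move=> n0 sQ Qn sp kp up E; set u := rev_conj k p in up E *.
have Qlead : Q`_n != 0 by rewrite -[n]/(n.+1.-1) -sQ -[Q`__]/(lead_coef Q) lead_coef_eq0 -size_poly_gt0 sQ.
have [Ep sR] := homog_lead_split p 'X^k sQ Qn n0.
have sQ' : size (conj_poly Q) = n.+1 by rewrite size_map_poly.
have Qn' : (conj_poly Q)`_n.-1 = 0 by rewrite coef_map Qn /= conjC0.
have [] := homog_lead_split u 'X^k sQ' Qn' n0; rewrite coef_map /= => Eu sR'.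
(* [m] is the order of the pole of [p / 'X^k] at infinity. *)
pose m := ((size p).-1 - k)%N; have m0 : (0 < m)%N by rewrite /m; lia.
have sp' : size p = (k + m).+1 by rewrite /m; lia.
have su' : (size u <= (k + m).+1)%N by rewrite -sp'.
have Qlead' : (Q`_n)^* != 0 by rewrite conjC_eq0.
have [r rn sd] : exists2 r, r ^+ n = (Q`_n)^* / Q`_n & (size (p - r *: u)%R <= k)%N.
  apply: (leading_ratio n0 m0) => //.
  have eq_sub (x y z t : {poly C}) : x + y = z + t -> x - z = t - y.
    by move/(canRL (addrK y)) ->; rewrite addrAC [z + t]addrC addrK.
  move: E; rewrite Ep Eu => /eq_sub ->.
  apply: leq_trans (size_polyD _ _) _; rewrite size_polyN geq_max.
  by apply/andP; split; apply: size_homog => //; rewrite sp'.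
have r1 := conj_norm1 n0 Qlead rn.
exists r => //; apply/eqP; rewrite -subr_eq0; apply/eqP.
apply: (rev_conj_fixed_small (r := - r^*) sd).
apply/polyP => i; rewrite coef_poly coefZ !coefB !coefZ.
case: ltnP => ik; last first.
  by rewrite !nth_default ?mulr0 ?subrr ?mulr0 ?(leq_trans sp) ?(leq_trans (size_rev_conj k p)).
have -> : u`_i = (p`_(k.*2 - i))^* by rewrite coef_poly ik.
have -> : u`_(k.*2 - i) = (p`_i)^* by rewrite coef_poly ltnS leq_subr subKn.
rewrite rmorphB rmorphM /= conjCK mulNr mulrBr opprB mulrA [r^* * r]mulrC r1.
by rewrite mul1r.
Qed.

(** Exchanging [p] with its reflection, [Q] with its conjugate and [r] with [r^*], one may assume
    that [p] has the larger size. If there were no pole at infinity, [rev_conj_const] would make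
    [p / 'X^k] constant. *)
Lemma rev_conj_proportional n k Q p : (0 < n)%N -> size Q = n.+1 -> Q`_n.-1 = 0 ->
    (size p <= k.*2.+1)%N -> p != p`_k *: 'X^k ->
    homog n Q p 'X^k = homog n (conj_poly Q) (rev_conj k p) 'X^k ->
  exists2 r, r * r^* = 1 & p = r *: rev_conj k p.
Proof.
move=> n0 sQ Qn sp ncp E; set u := rev_conj k p.
have [up|pu] := leqP (size u) (size p).
  apply: (rev_conj_proportional_aux n0 sQ Qn) => //.
  rewrite ltnNge; apply: contra ncp => sp'; apply/eqP/rev_conj_const => //.
  exact: leq_trans up sp'.
have uu : rev_conj k u = p by exact: rev_conjK.
have sQ' : size (conj_poly Q) = n.+1 by rewrite size_map_poly.
have Qn' : (conj_poly Q)`_n.-1 = 0 by rewrite coef_map Qn /= conjC0.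
have [] := @rev_conj_proportional_aux n k (conj_poly Q) u n0 sQ' Qn' (size_rev_conj k p).
- rewrite ltnNge; apply: contra ncp => su; apply/eqP/rev_conj_const => //.
  exact: leq_trans (ltnW pu) su.
- by rewrite uu ltnW.
- by rewrite uu [conj_poly (conj_poly Q)](_ : _ = Q) //; apply/polyP => i; rewrite !coef_map /= conjCK.
move=> r r1 uE; exists r^*; first by rewrite conjCK mulrC.
by rewrite uE uu scalerA mulrC r1 scale1r.
Qed.

End Reversal.

(** * Decompositions of invariant Laurent polynomials *)

Section RealDecompositions.
Variables (C : numClosedFieldType) (K : fieldType).
Variables (ev : {rmorphism {poly C} -> K}) (sig : {rmorphism K -> K}).
Implicit Types (a b p q Q : {poly C}) (L W : K).
Local Notation conj_poly := (map_poly (@Num.conj C)).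
Local Notation z := (ev 'X).
Local Notation scalar := (scalar ev).
Local Notation eval_at := (eval_at ev).
Local Notation laurent := (laurent ev).

Hypothesis ev_neq0 : forall p, p != 0 -> ev p != 0.
Hypothesis ev_frac : forall W, exists p q, [/\ q != 0, coprimep p q & W = ev p / ev q].
Hypothesis sig_scalar : forall c, sig (scalar c) = scalar c^*.
Hypothesis sig_var : sig z = z^-1.

Let z0 : z != 0 := var_neq0 ev_neq0.

Lemma sig_at W a : sig (eval_at W a) = eval_at (sig W) (conj_poly a).
Proof.
elim/poly_ind: a => [|a c IH]; first by rewrite !rmorph0.
rewrite !rmorphD !rmorphM /= IH map_polyX map_polyC !eval_atX !eval_atC.
by rewrite sig_scalar.
Qed.

Lemma sig_ev k p : (size p <= k.*2.+1)%N ->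
  sig (ev p) = ev (rev_conj k p) / z ^+ k.*2.
Proof.
move=> sp; have ev_at_z q : ev q = eval_at z q.
  elim/poly_ind: q => [|q c IH]; first by rewrite !rmorph0.
  by rewrite !rmorphD !rmorphM /= IH eval_atX eval_atC.
rewrite [ev p]ev_at_z [ev (rev_conj k p)]ev_at_z sig_at sig_var.
rewrite (eval_at_wide _ _ (n := k.*2.+1)) ?size_map_poly //.
rewrite (eval_at_wide _ _ (size_rev_conj k p)) mulr_suml.
rewrite (reindex_inj rev_ord_inj); apply: eq_bigr => i _ /=.
have := ltn_ord i; rewrite ltnS => ik.
rewrite coef_map coef_poly subSS (ltn_ord i) -mulrA; congr (_ * _).
have -> : z ^+ k.*2 = z ^+ (k.*2 - i) * z ^+ i by rewrite -exprD subnK.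
by rewrite exprVn invfM mulrCA divff ?mulr1 // expf_neq0.
Qed.

Lemma laurent_rev W : laurent W -> exists k p, [/\ (size p <= k.*2.+1)%N,
  W = ev p / z ^+ k & sig W = ev (rev_conj k p) / z ^+ k].
Proof.
(* Multiplying numerator and denominator by ['X^s] widens the range of exponents, from [-(k + s)] to
   [k + s], until [p] fits. *)
move=> [p [k ->]]; pose s := size p.
have sp : (size (p * 'X^s)%R <= (k + s).*2.+1)%N.
  have [->|p0] := eqVneq p 0; first by rewrite mul0r size_poly0.
  by rewrite size_mulXn // /s; lia.
exists (k + s)%N, (p * 'X^s).
have -> : ev p / z ^+ k = ev (p * 'X^s) / z ^+ (k + s).
  rewrite rmorphM rmorphXn exprD.
  by field; rewrite !expf_neq0.
split=> //; rewrite fmorph_div rmorphXn /= sig_var (sig_ev sp) exprVn invrK.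
move: (ev (rev_conj _ _)) => x; rewrite -addnn [z ^+ (_ + _)%N in X in X * _]exprD.
by rewrite -mulrA invfM mulfVK ?expf_neq0.
Qed.

(** Given by coefficients because the abstract field [K] has no composition; [descent] rebuilds [v]
    from them. *)
Definition real_homography W := exists a b c d : C, a * d - b * c != 0 /\
  let V := (scalar a * W + scalar b) / (scalar c * W + scalar d) in sig V = V.

Lemma sig_proportional n Q W : (0 < n)%N -> size Q = n.+1 -> Q`_n.-1 = 0 ->
    laurent W -> (forall c, W != scalar c) -> sig (eval_at W Q) = eval_at W Q ->
  exists2 r, r * r^* = 1 & W = scalar r * sig W.
Proof.
move=> n0 sQ Qn /laurent_rev[k [p [sp WE UE]]] ncW; rewrite sig_at => E.
have zk : ev 'X^k = z ^+ k by rewrite rmorphXn.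
have X0 : 'X^k != 0 :> {poly C} by rewrite monic_neq0 ?monicXn.
have [||r r1 pE] := @rev_conj_proportional C n k Q p n0 sQ Qn sp.
- apply: contraNneq (ncW p`_k) => pE.
  by rewrite WE pE ev_scale zk coefZ coefXn eqxx mulr1 mulfK ?expf_neq0.
- apply: (ev_inj ev_neq0); rewrite !(ev_homog ev_neq0) ?size_map_poly ?sQ //.
  by rewrite zk -WE -UE E.
by exists r; rewrite // UE WE {1}pE ev_scale mulrA.
Qed.

Lemma coef_exp_XsubC (s : C) n : (('X - s%:P) ^+ n.+1)`_n = - s *+ n.+1.
Proof.
elim: n => [|n IH]; first by rewrite expr1 coefB coefX coefC sub0r.
rewrite exprSr mulrBr coefB coefMX coefMC /= IH.
have -> : (('X - s%:P) ^+ n.+1)`_n.+1 = 1.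
  by have /eqP := monic_exp n.+1 (monicXsubC s); rewrite lead_coefE size_exp_XsubC.
by rewrite mul1r [RHS]mulrS addrC.
Qed.

Lemma polynomial_case Q W : (1 < size Q)%N -> laurent W ->
    (forall c, W != scalar c) -> sig (eval_at W Q) = eval_at W Q -> real_homography W.
Proof.
move=> sQ1 lW ncW LE; pose n := (size Q).-1.
have n0 : (0 < n)%N by rewrite /n; lia.
have sQ : size Q = n.+1 by rewrite /n; lia.
have Qlead : Q`_n != 0 by rewrite -[Q`__]/(lead_coef Q) lead_coef_eq0 -size_poly_gt0 sQ.
have nC : n%:R != 0 :> C by rewrite pnatr_eq0 -lt0n.
(* The shift [s] solves [Q_(n-1) - n s Q_n = 0], whose left side is the coefficient of degree
   [n - 1] of [Q1]. *)
pose s := Q`_n.-1 / (Q`_n * n%:R); pose Q1 := Q \Po ('X - s%:P).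
have sQ1' : size Q1 = n.+1 by rewrite size_comp_poly2 // size_XsubC.
have Qn1 : Q1`_n.-1 = 0.
  rewrite coef_comp_poly sQ; rewrite -(prednK n0) big_ord_recr big_ord_recr /=.
  rewrite coef_exp_XsubC big1 ?add0r; last first.
    move=> i _; rewrite [_`_n.-1]nth_default ?mulr0 // size_exp_XsubC.
    exact: ltn_ord.
  have -> : (('X - s%:P) ^+ n.-1)`_n.-1 = 1.
    by have /eqP := monic_exp n.-1 (monicXsubC s); rewrite lead_coefE size_exp_XsubC.
  rewrite prednK // -mulr_natr /s; field.
  by rewrite Qlead nC.
pose W1 := W + scalar s.
have Q1E : eval_at W1 Q1 = eval_at W Q.
  by rewrite eval_at_comp rmorphB /= eval_atX eval_atC addrK.
have lW1 : laurent W1 by apply: laurentD => //; apply: laurent_ev.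
have ncW1 c : W1 != scalar c.
  by rewrite -subr_eq0 -addrA -rmorphB -[s - c]opprB rmorphN subr_eq0 ncW.
have [|r r1 W1E] := sig_proportional n0 sQ1' Qn1 lW1 ncW1; first by rewrite Q1E.
(* Hilbert 90 for [r * r^* = 1] *)
have [t t0 tE] : exists2 t, t != 0 & t^* = t * r.
  have [->|rN1] := eqVneq r (-1); first by exists 'i; rewrite ?neq0Ci // conjCi mulrN1.
  exists (1 + r^*); last by rewrite rmorphD rmorph1 /= conjCK mulrDl mul1r [r^* * r]mulrC r1 addrC.
  apply: contraNneq rN1 => /(congr1 (@Num.conj C)) /=.
  by rewrite rmorphD rmorph1 conjC0 /= conjCK addrC => /eqP; rewrite addr_eq0.
(* Here [V = t W1], and [sig V = t^* sig W1 = t r sig W1 = V]. *)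
exists t, (t * s), 0, 1; split; first by rewrite mulr1 mulr0 subr0.
rewrite /= rmorph0 rmorph1 mul0r add0r divr1 rmorphM -mulrDr -/W1.
by rewrite (rmorphM sig) /= sig_scalar tE rmorphM -mulrA -W1E.
Qed.

(** The new matrix is the old one times that of [w -> 1 / (w - c)], with rows [0, 1] and [1, -c] and
    determinant -1. *)
Lemma real_homography_inv W c : W - scalar c != 0 ->
  real_homography (W - scalar c)^-1 -> real_homography W.
Proof.
move=> nz [a [b [a' [b' [D E]]]]].
exists b, (a - b * c), b', (a' - b' * c); split.
  rewrite [X in X != 0](_ : _ = - (a * b' - b * a')) ?oppr_eq0 //.
  by ring.
move: E => /=; suff -> : (scalar b * W + scalar (a - b * c)) / (scalar b' * W + scalar (a' - b' * c)) =
  (scalar a * (W - scalar c)^-1 + scalar b) / (scalar a' * (W - scalar c)^-1 + scalar b') by [].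
rewrite !rmorphB !rmorphM /=.
have H x y : scalar x * (W - scalar c)^-1 + scalar y =
  (scalar y * W + (scalar x - scalar y * scalar c)) / (W - scalar c) by field.
by rewrite !H invf_div mulrA divfK.
Qed.

(* The witness is the Cayley transform of [Z = z ^+ i / z ^+ j], for which
   [sig Z = Z^-1]. *)
Lemma unit_case W c d i j : c != 0 -> (forall c, W != scalar c) ->
  W - scalar d = scalar c * z ^+ i / z ^+ j -> real_homography W.
Proof.
move=> c0 ncW WE.
have c0' : scalar c != 0 by rewrite fmorph_eq0.
(* The coefficients of ['i (1 - Z) / (1 + Z)] for [Z = (W - d) / c], after clearing [c]. *)
exists (- 'i), ('i * (c + d)), 1, (c - d); split.
  rewrite [X in X != 0](_ : _ = - (2%:R * 'i * c)); last by ring.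
  by rewrite oppr_eq0 !mulf_neq0 ?neq0Ci // pnatr_eq0.
pose Z := z ^+ i / z ^+ j.
have Z0 : Z != 0 by rewrite mulf_neq0 ?invr_eq0 ?expf_neq0.
have sigZ : sig Z = Z^-1.
  by rewrite fmorph_div !rmorphXn /= sig_var !exprVn invrK invf_div mulrC.
have {}WE : W = scalar c * Z + scalar d by rewrite mulrA -WE subrK.
have Z1 : 1 + Z != 0.
  apply: contraNneq (ncW (d - c)) => /(canRL (addKr _)); rewrite addr0 => ZE.
  by rewrite WE ZE rmorphB /= mulrN1 addrC.
move=> /=; set V := _ / _; have -> : V = scalar 'i * (1 - Z) / (1 + Z).
  rewrite /V WE rmorph1 rmorphN !rmorphM !rmorphD rmorphN /=.
  move: (scalar 'i) (scalar c) (scalar d) c0' => x y t y0.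
  have -> : 1 * (y * Z + t) + (y - t) = y * (1 + Z) by ring.
  by field; rewrite y0 Z1.
rewrite fmorph_div rmorphM rmorphB rmorphD rmorph1 /= sig_scalar sigZ conjCi rmorphN /=.
move: (scalar 'i) Z0 Z1 => x Z0 Z1; field.
by rewrite Z0 Z1.
Qed.

(** Once [a / b] is in lowest terms, a constant denominator leads to [polynomial_case]; otherwise a
    root [d] of the denominator is a second pole and leads to [unit_case]. *)
Lemma infinite_pole_case L W a b : (forall c, W != scalar c) ->
    laurent L -> sig L = L -> b != 0 -> (size b < size a)%N ->
    eval_at W a = L * eval_at W b -> real_homography W.
Proof.
move=> ncW lL LL b0 sab E; have tW := eval_at_neq0 ncW.
have lW : laurent W by apply: laurent_integral E.
pose g := gcdp a b; have g0 : g != 0 by rewrite gcdp_eq0 negb_and b0 orbT.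
pose a1 := a %/ g; pose b1 := b %/ g.
have aE : a = a1 * g by rewrite divpK ?dvdp_gcdl.
have bE : b = b1 * g by rewrite divpK ?dvdp_gcdr.
have cab : coprimep a1 b1 by rewrite coprimep_div_gcd // b0 orbT.
have b10 : b1 != 0 by apply: contraNneq b0; rewrite bE => ->; rewrite mul0r.
have a10 : a1 != 0.
  by apply: contraTneq sab; rewrite aE => ->; rewrite mul0r size_poly0.
have {}sab : (size b1 < size a1)%N.
  move: sab; rewrite aE bE !size_mul //; have := size_poly_gt0 g; rewrite g0.
  by move: (size g) (size a1) (size b1) => x y t x0; lia.
have {}E : eval_at W a1 = L * eval_at W b1.
  apply: (mulIf (tW _ g0)); rewrite -mulrA -!rmorphM /= -aE -bE.
  exact: E.
have [sb|sb] := eqVneq (size b1) 1%N.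
  have /eqP/size_poly1P[c c0 bC] := sb.
  pose Q := c^-1 *: a1; have LQ : L = eval_at W Q.
    rewrite /Q -mul_polyC rmorphM /= eval_atC E bC eval_atC mulrCA -rmorphM /= mulVf //.
    by rewrite rmorph1 mulr1.
  apply: (polynomial_case (Q := Q)) => //; last by rewrite -LQ.
  by rewrite size_scale ?invr_eq0 // -sb.
have [d db] := closed_rootP b1 sb.
have ad : a1.[d] != 0 by apply: coprimep_root db; rewrite coprimep_sym.
have [b2 b2E] := factor_theorem _ _ db.
have /factor_theorem[a2 a2E] : root (a1 - a1.[d]%:P) d by rewrite rootE !hornerE subrr.
pose al := scalar a1.[d]; have al0 : al != 0 by rewrite fmorph_eq0.
have atXd : eval_at W ('X - d%:P) = W - scalar d by rewrite rmorphB /= eval_atX eval_atC.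
(* From [a1 = a1(d) + (X - d) a2], [b1 = (X - d) b2] and [a1(W) = L b1(W)] one gets
   [a1(d) = (W - d) (L b2(W) - a2(W))]: [W - d] has an inverse among the Laurent polynomials. *)
have U : (W - scalar d) * ((L * eval_at W b2 - eval_at W a2) * scalar (a1.[d])^-1) = 1.
  rewrite fmorphV /= -/al mulrA; apply: (canLR (mulfK al0)); rewrite mul1r.
  have -> : al = eval_at W a1 - eval_at W a2 * (W - scalar d).
    by rewrite -atXd -rmorphM -a2E rmorphB /= eval_atC subKr.
  by rewrite E b2E rmorphM /= atXd; ring.
have lWd : laurent (W - scalar d).
  by rewrite -rmorphN; apply: laurentD => //; apply: laurent_ev.
have lV : laurent ((L * eval_at W b2 - eval_at W a2) * scalar (a1.[d])^-1).
  apply: laurentM; last exact: laurent_ev.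
  rewrite -mulN1r -(rmorphN1 scalar); apply: laurentD => //; last first.
    by apply: laurentM; [exact: laurent_ev | exact: laurent_at].
  by apply: laurentM => //; exact: laurent_at.
have [c c0 [i [j WE]]] := laurent_unit ev_neq0 lWd lV U.
exact: unit_case WE.
Qed.

Lemma eval_at_reverse n W a : W != 0 -> (size a <= n.+1)%N ->
  eval_at W a = W ^+ n * eval_at W^-1 (\poly_(i < n.+1) a`_(n - i)).
Proof.
move=> W0 sa; rewrite (eval_at_wide _ _ sa) (eval_at_wide _ _ (size_poly _ _)) mulr_sumr.
rewrite (reindex_inj rev_ord_inj); apply: eq_bigr => i _ /=.
rewrite coef_poly ltn_ord subSS mulrCA; congr (_ * _).
have in_ : (i <= n)%N by rewrite -ltnS.
have -> : W ^+ n = W ^+ (n - i) * W ^+ i by rewrite -exprD subnK.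
by rewrite exprVn mulfK // expf_neq0.
Qed.

(** If [a / b] has no pole at infinity, a finite pole [d] is moved there by passing to [(W - d)^-1];
    shifting by [d] and reversing coefficients gives the new numerator and denominator. *)
Lemma decomposition_case L W a b : (forall c, W != scalar c) ->
    laurent L -> sig L = L -> (forall c, L != scalar c) -> coprimep a b -> b != 0 ->
    eval_at W a = L * eval_at W b -> real_homography W.
Proof.
move=> ncW lL LL ncL cab b0 E; have tW := eval_at_neq0 ncW.
have [sab|sba] := ltnP (size b) (size a); first exact: infinite_pole_case E.
have sb1 : size b != 1%N.
  apply/eqP => sb; have /size_poly1P[c c0 bC] : size b == 1%N by rewrite sb.
  have aC : a = (a`_0)%:P by apply: size1_polyC; rewrite -sb.
  have/eqP := ncL (a`_0 / c); apply; rewrite fmorph_div /=.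
  by move: E; rewrite {1}aC bC !eval_atC => ->; rewrite mulfK // fmorph_eq0.
have [d db] := closed_rootP b sb1.
have ad : a.[d] != 0 by apply: coprimep_root db; rewrite coprimep_sym.
have Wd : W - scalar d != 0 by rewrite subr_eq0.
apply: (real_homography_inv Wd).
have ncWd c : (W - scalar d)^-1 != scalar c.
  apply: contraNneq (ncW (c^-1 + d)) => /(canRL invrK).
  by rewrite rmorphD fmorphV /= => <-; rewrite subrK.
pose sh p := p \Po ('X + d%:P).
have shE p : eval_at W p = eval_at (W - scalar d) (sh p).
  by rewrite eval_at_comp rmorphD /= eval_atX eval_atC subrK.
have ssh p : size (sh p) = size p.
  by rewrite size_comp_poly2 // -[d]opprK rmorphN size_XsubC.
have sh0 p : (sh p)`_0 = p.[d].
  by rewrite -horner_coef0 horner_comp !hornerE.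
pose n := (size b).-1; have sb : size b = n.+1 by rewrite prednK // size_poly_gt0.
have sa : (size (sh a) <= n.+1)%N by rewrite ssh -sb.
have sb' : (size (sh b) <= n.+1)%N by rewrite ssh -sb.
pose rv p := \poly_(i < n.+1) (sh p)`_(n - i).
have {}E : eval_at (W - scalar d)^-1 (rv a) = L * eval_at (W - scalar d)^-1 (rv b).
  apply: (mulfI (expf_neq0 n Wd)); rewrite mulrCA -!eval_at_reverse // -!shE.
  exact: E.
apply: infinite_pole_case E => //.
  apply: contraTneq (tW _ b0) => rb0.
  by rewrite shE (eval_at_reverse Wd sb') -/(rv b) rb0 rmorph0 mulr0 eqxx.
(* The coefficient of degree [n] is [a.[d]], nonzero, in [rv a], and [b.[d] = 0] in [rv b]. *)
have -> : size (rv a) = n.+1 by rewrite size_poly_eq // subnn sh0.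
rewrite ltnS; apply/leq_sizeP => i; rewrite leq_eqVlt => /orP[/eqP<-|ni].
  by rewrite coef_poly ltnSn subnn sh0; apply/eqP.
by rewrite nth_default // (leq_trans (size_poly _ _)).
Qed.

End RealDecompositions.

(** * Composition of rational functions *)

HB.instance Definition _ (K : fieldType) :=
  GRing.RMorphism.copy (@rconst K) (@tofrac _ \o polyC).

Lemma homography_inv (F : fieldType) (a b c d x : F) :
  a * d - b * c != 0 -> c * x + d != 0 ->
  let y := (a * x + b) / (c * x + d) in (d * y + - b) / (- c * y + a) = x.
Proof.
move=> D nz /=; field; rewrite nz /=.
by have -> : - c * (a * x + b) + a * (c * x + d) = a * d - b * c by ring.
Qed.

Section Composition.
Variable K : closedFieldType.
Implicit Types (p q : {poly K}) (F G W : {fraction {poly K}}).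

Local Notation subst_at := (eval_at (@tofrac {poly K})).

Definition nonconst W := forall c, W != rconst c.

Lemma nonconst_rvar : nonconst rvar.
Proof.
move=> c; rewrite tofrac_eq; apply/eqP => /(congr1 (coefp 1)) /eqP.
by rewrite /= coefX coefC oner_eq0.
Qed.

Lemma subst_at_neq0 G : nonconst G -> forall p : {poly K}, p != 0 -> subst_at G p != 0.
Proof. exact: (eval_at_neq0 (ev := @tofrac {poly K})). Qed.

(** Right composition with a nonconstant [G] is a field morphism: by conversion it is the extension
    to fractions of evaluation at [G]. *)
Definition comp_right G of nonconst G := fun F => rcomp F G.

HB.instance Definition _ G (ncG : nonconst G) :=
  GRing.RMorphism.copy (comp_right ncG) (frac_map (subst_at_neq0 ncG)).

Lemma rcomp_tofrac G (p : {poly K}) : nonconst G -> rcomp p%:F G = subst_at G p.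
Proof. by move=> ncG; apply: (frac_map_tofrac (subst_at_neq0 ncG)). Qed.

Lemma rcomp_const G c : nonconst G -> rcomp (rconst c) G = rconst c.
Proof. by move=> ncG; rewrite rcomp_tofrac // eval_atC. Qed.

Lemma rcomp_var G : nonconst G -> rcomp rvar G = G.
Proof. by move=> ncG; rewrite rcomp_tofrac // eval_atX. Qed.

Lemma subst_at_rvar (p : {poly K}) : subst_at rvar p = p%:F.
Proof.
elim/poly_ind: p => [|p c IH]; first by rewrite rmorph0 tofrac0.
by rewrite rmorphD rmorphM /= IH eval_atX eval_atC tofracD tofracM.
Qed.

Lemma rcomp_subst_at G H (p : {poly K}) : nonconst G ->
  rcomp (subst_at H p) G = subst_at (rcomp H G) p.
Proof.
move=> ncG; rewrite -![rcomp _ G]/(comp_right ncG _).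
elim/poly_ind: p => [|p c IH]; first by rewrite !rmorph0.
rewrite !rmorphD !rmorphM /= IH !eval_atX !eval_atC; congr (_ + _).
exact: rcomp_const.
Qed.

Lemma rcompA F G H : nonconst G -> rcomp (rcomp F H) G = rcomp F (rcomp H G).
Proof.
move=> ncG; rewrite -[rcomp (rcomp F H) G]/(comp_right ncG _) fmorph_div /=.
by congr (_ / _); apply: rcomp_subst_at.
Qed.

Definition mobius a b c d G : {fraction {poly K}} :=
  (rconst a * G + rconst b) / (rconst c * G + rconst d).

Lemma linear_neq0 c d G : nonconst G -> (c != 0) || (d != 0) ->
  rconst c * G + rconst d != 0.
Proof.
move=> ncG; have [-> /= d0|c0 _] := eqVneq c 0.
  by rewrite rmorph0 mul0r add0r fmorph_eq0.
rewrite addr_eq0; apply/eqP => E; have/eqP := ncG (- d / c); apply.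
apply: (mulfI (x := rconst c)); first by rewrite fmorph_eq0.
by rewrite E fmorph_div rmorphN mulrC divfK // fmorph_eq0.
Qed.

Lemma det_neq0_row a b c d : a * d - b * c != 0 :> K -> (c != 0) || (d != 0).
Proof. by apply: contraNT; rewrite negb_or !negbK => /andP[/eqP-> /eqP->]; rewrite !mulr0 subrr. Qed.

(** A constant value [e] would be a linear relation on [G] with coefficients [a - e c] and
    [b - e d], which cannot both vanish when the determinant is nonzero. *)
Lemma nonconst_mobius a b c d G : a * d - b * c != 0 -> nonconst G ->
  nonconst (mobius a b c d G).
Proof.
move=> D ncG e; have nz := linear_neq0 ncG (det_neq0_row D).
apply/eqP => /(canRL (mulfVK nz))/eqP; rewrite -subr_eq0.
have -> : rconst a * G + rconst b - rconst e * (rconst c * G + rconst d)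
   = rconst (a - e * c) * G + rconst (b - e * d).
  by rewrite !rmorphB !rmorphM; ring.
apply/negP/linear_neq0 => //; apply: contraNT D; rewrite negb_or !negbK.
by rewrite !subr_eq0 => /andP[/eqP-> /eqP->]; apply/eqP; ring.
Qed.

Lemma mobiusK a b c d G : a * d - b * c != 0 -> nonconst G ->
  mobius d (- b) (- c) a (mobius a b c d G) = G.
Proof.
move=> D ncG; have nz := linear_neq0 ncG (det_neq0_row D).
have D' : rconst a * rconst d - rconst b * rconst c != 0.
  by rewrite -!rmorphM -rmorphB fmorph_eq0.
have N x : rconst (- x) = - rconst x :> {fraction {poly K}} by exact: rmorphN.
rewrite /mobius !N.
exact: (homography_inv D' nz).
Qed.

Lemma rcomp_mobius a b c d G : nonconst G ->
  rcomp (mobius a b c d rvar) G = mobius a b c d G.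
Proof.
move=> ncG; rewrite -[LHS]/(comp_right ncG _) fmorph_div !rmorphD !rmorphM /=.
have C x : comp_right ncG (rconst x) = rconst x by exact: rcomp_const.
by rewrite !C [comp_right _ _](rcomp_var ncG).
Qed.

Lemma rdeg_mobius a b c d : a * d - b * c != 0 -> rdeg (mobius a b c d rvar) = 1%N.
Proof.
move=> D; have cd := det_neq0_row D.
have E (x y : K) : rconst x * rvar + rconst y = (x%:P * 'X + y%:P)%:F.
  by rewrite tofracD tofracM.
have q0 : c%:P * 'X + d%:P != 0 :> {poly K}.
  by rewrite -tofrac_eq0 -E linear_neq0 //; apply: nonconst_rvar.
rewrite /mobius !E rdeg_coprime //; last first.
  apply/Bezout_coprimepP; exists (- c%:P, a%:P) => /=.
  have -> : - c%:P * (a%:P * 'X + b%:P) + a%:P * (c%:P * 'X + d%:P) =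
    (a * d - b * c)%:P :> {poly K} by rewrite rmorphB !rmorphM; ring.
  by rewrite -size_poly_eq1 size_polyC D.
rewrite !size_MXaddC !polyC_eq0 !size_polyC.
case: (eqVneq a 0) D => [->|a0]; case: (eqVneq c 0) => [->|c0] //=.
- by rewrite !(mul0r, mulr0) subrr eqxx.
- by case: ifP.
- by case: ifP.
Qed.

End Composition.

(** * The involution [sigma] and descent to real coefficients *)

Section Reflection.
Variable R : realType.
Local Notation C := R[i].
Implicit Types (p q : {poly C}) (F G W : {fraction {poly C}}).
Local Notation subst_at := (eval_at (@tofrac {poly C})).
Local Notation conj_poly := (map_poly (@conjc R)).

Lemma tofrac_conj_neq0 (p : {poly C}) : p != 0 -> (@tofrac _ \o conj_poly) p != 0.
Proof. by move=> p0; rewrite /= tofrac_eq0 map_poly_eq0. Qed.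

Lemma nonconst_inv W : nonconst W -> nonconst W^-1.
Proof.
move=> ncW c; apply/eqP => E; have/eqP := ncW c^-1; apply.
by rewrite -[W]invrK E -fmorphV.
Qed.

Definition sigma F := rcomp (rbar F) rvar^-1.

HB.instance Definition _ := GRing.RMorphism.copy (@rbar R)
  (frac_map tofrac_conj_neq0).

Lemma nonconst_invX : nonconst (rvar^-1 : {fraction {poly C}}).
Proof. exact/nonconst_inv/nonconst_rvar. Qed.

Lemma sigma_is_zmod_morphism : zmod_morphism sigma.
Proof.
move=> F G; rewrite /sigma (rmorphB (@rbar R)).
exact: (rmorphB (comp_right nonconst_invX)).
Qed.

Lemma sigma_is_monoid_morphism : monoid_morphism sigma.
Proof.
split.
  by rewrite /sigma (rmorph1 (@rbar R)); apply: (rmorph1 (comp_right nonconst_invX)).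
move=> F G; rewrite /sigma (rmorphM (@rbar R)).
exact: (rmorphM (comp_right nonconst_invX)).
Qed.

HB.instance Definition _ := GRing.isZmodMorphism.Build _ _ sigma
  sigma_is_zmod_morphism.
HB.instance Definition _ := GRing.isMonoidMorphism.Build _ _ sigma
  sigma_is_monoid_morphism.

Lemma sigma_div F G : sigma (F / G) = sigma F / sigma G.
Proof. exact: (fmorph_div sigma). Qed.

Lemma sigma_tofrac p : sigma p%:F = subst_at rvar^-1 (conj_poly p).
Proof.
rewrite /sigma [rbar _](frac_map_tofrac tofrac_conj_neq0).
exact: (rcomp_tofrac _ nonconst_invX).
Qed.

Lemma sigma_const c : sigma (rconst c) = rconst c^*%C.
Proof. by rewrite sigma_tofrac map_polyC eval_atC. Qed.

Lemma sigma_var : sigma rvar = rvar^-1.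
Proof. by rewrite sigma_tofrac map_polyX eval_atX. Qed.

Lemma sigma_subst_at G p : sigma (subst_at G p) = subst_at (sigma G) (conj_poly p).
Proof.
elim/poly_ind: p => [|p c IH]; first by rewrite !rmorph0.
rewrite !rmorphD !rmorphM /= IH map_polyX map_polyC !eval_atX !eval_atC.
by rewrite sigma_const.
Qed.

Lemma conj_polyK : involutive conj_poly.
Proof.
by move=> p; rewrite -map_poly_comp map_poly_id // => x _; apply: conjcK.
Qed.

Lemma sigmaK : involutive sigma.
Proof.
have K p : sigma (sigma p%:F) = p%:F.
  rewrite -{1}[p%:F]subst_at_rvar !sigma_subst_at conj_polyK sigma_var.
  by rewrite fmorphV /= sigma_var invrK subst_at_rvar.
move=> F; rewrite [F]fracE.
by rewrite (sigma_div (rnum F)%:F) (sigma_div (sigma _)) !K.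
Qed.

Lemma nonconst_sigma W : nonconst W -> nonconst (sigma W).
Proof.
move=> ncW c; apply/eqP => E; have/eqP := ncW c^*%C; apply.
by rewrite -sigma_const -E sigmaK.
Qed.

(** When [sigma V = V], this turns invariance of the composite into an equation between [P] and
    [rbar P]. *)
Lemma sigma_rcomp P V : nonconst V -> sigma (rcomp P V) = rcomp (rbar P) (sigma V).
Proof.
move=> ncV; rewrite [LHS](sigma_div (subst_at V _)) !sigma_subst_at.
have ncU := nonconst_sigma ncV.
rewrite [RHS](fmorph_div (comp_right ncU) (conj_poly (rnum P))%:F).
by congr (_ / _); symmetry; apply: rcomp_tofrac ncU.
Qed.

Lemma real_poly p : conj_poly p = p ->
  p = map_poly (real_complex R) (map_poly (@complex.Re R) p).
Proof.
move=> pE; apply/polyP => i; rewrite coef_map /= coef_map_id0 //.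
move/polyP/(_ i): pE; rewrite coef_map /=; case: (p`_i) => x y [] /eqP.
by rewrite eqNr => /eqP ->.
Qed.

(** Numerator and denominator are multiplied by the conjugate of the denominator. The new
    denominator is then self-conjugate, and so is the new numerator, by cross-multiplying
    [rbar F = F]. *)
Lemma real_ratfun F : rbar F = F -> in_real_ratfun F.
Proof.
move=> FE; have d0 := rden_neq0 F.
have d0' : conj_poly (rden F) != 0 by rewrite map_poly_eq0.
pose p := rnum F * conj_poly (rden F); pose q := rden F * conj_poly (rden F).
have q0 : q != 0 by rewrite mulf_neq0.
have pE : conj_poly p = p.
  rewrite rmorphM /= conj_polyK; apply/eqP; rewrite -tofrac_eq !tofracM.
  by rewrite -eqr_div ?tofrac_eq0 // -fracE; apply/eqP.
have qE : conj_poly q = q by rewrite rmorphM /= conj_polyK mulrC.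
exists (map_poly (@complex.Re R) p), (map_poly (@complex.Re R) q); split.
  by apply: contraNneq q0 => E; rewrite (real_poly qE) E rmorph0.
rewrite -!real_poly // !tofracM -mulf_div divff ?mulr1 ?tofrac_eq0 //.
exact: fracE.
Qed.

Lemma descent P W a b c d (V := mobius a b c d W) :
    nonconst W -> a * d - b * c != 0 -> sigma V = V ->
    sigma (rcomp P W) = rcomp P W ->
  exists v vinv, [/\ rdeg v = 1%N, is_comp_inverse v vinv,
    in_real_ratfun (rcomp P vinv) & in_LR_field (rcomp v W)].
Proof.
move=> ncW D VE LE.
have ncX := @nonconst_rvar R[i].
have D' : d * a - (- b) * (- c) != 0 by rewrite mulrNN [d * a]mulrC.
pose v := mobius a b c d rvar; pose vi := mobius d (- b) (- c) a rvar.
have ncV : nonconst V by apply: nonconst_mobius.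
have ncv : nonconst v by exact: (nonconst_mobius D ncX).
have ncvi : nonconst vi by exact: (nonconst_mobius D' ncX).
have viV : rcomp vi V = W by rewrite /vi (rcomp_mobius _ _ _ _ ncV) /V (mobiusK D ncW).
have vV : rcomp v W = V by rewrite /v (rcomp_mobius _ _ _ _ ncW).
clearbody V.
exists v, vi; split.
- exact: (rdeg_mobius D).
- split.
    rewrite /v (rcomp_mobius _ _ _ _ ncvi).
    by have := mobiusK D' ncX; rewrite !opprK.
  by rewrite /vi (rcomp_mobius _ _ _ _ ncv) /v (mobiusK D ncX).
- apply: real_ratfun; set Q := rcomp P vi.
  have QV : rcomp Q V = rcomp P W by rewrite (rcompA _ _ ncV) viV.
  have := sigma_rcomp Q ncV; rewrite VE QV LE -QV => E.
  exact: (fmorph_inj (comp_right ncV) (esym E)).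
- by rewrite /in_LR_field -/(sigma _) vV VE.
Qed.

End Reflection.

Unset Implicit Arguments.

Theorem corollary2p1 (R : realType) (L P W : {fraction {poly R[i]}})
    (hL : in_LR_ring L) (hLR : ~ is_real_const L) (hdec : L = rcomp P W) :
  exists v vinv : {fraction {poly R[i]}},
    [/\ rdeg v = 1%N, is_comp_inverse v vinv,
        in_real_ratfun (rcomp P vinv) & in_LR_field (rcomp v W)].
Proof.
have [lL LL] := hL; rewrite /in_LR_field -/(sigma L) in LL.
have ncL : nonconst L.
  (* A constant fixed by [sigma] equals its conjugate, so it is real. *)
  move=> c; apply/eqP => Lc; apply: hLR; rewrite Lc in LL *.
  rewrite sigma_const in LL; move/fmorph_inj: LL => /= cE.
  exists (complex.Re c); congr rconst; case: c cE {Lc} => x y [] /eqP.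
  by rewrite eqNr => /eqP ->.
have ncW : nonconst W.
  (* A constant [W] makes [L] constant even at a pole [c] of [P], where both quotients take the
     default value 0. *)
  move=> c; apply/eqP => Wc; have /eqP := ncL ((rnum P).[c] / (rden P).[c]).
  apply; rewrite hdec Wc /rcomp /rsubst !horner_map fmorph_div.
  reflexivity.
have E : eval_at (@tofrac {poly R[i]}) W (rnum P) = L * eval_at (@tofrac {poly R[i]}) W (rden P).
  rewrite hdec; symmetry; apply: divfK.
  exact: (subst_at_neq0 ncW (rden_neq0 P)).
have [a [b [c [d [D VE]]]]] : real_homography (@tofrac {poly R[i]}) (@sigma R) W.
  have h1 (p : {poly R[i]}) : p != 0 -> p%:F != 0 by rewrite tofrac_eq0.
  have h2 (F : {fraction {poly R[i]}}) : exists p q : {poly R[i]},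
      [/\ q != 0, coprimep p q & F = p%:F / q%:F].
    exists (rnum F), (rden F); split; [exact: rden_neq0 | exact: coprimep_rnum_rden | exact: fracE].
  have h3 c : sigma (scalar (@tofrac {poly R[i]}) c) = scalar (@tofrac {poly R[i]}) c^*.
    exact: sigma_const.
  have h4 := sigma_var R.
  have h5 := coprimep_rnum_rden P.
  have h6 := rden_neq0 P.
  exact: (decomposition_case h1 h2 h3 h4 ncW lL LL ncL h5 h6 E).
apply: (descent ncW D VE); rewrite -hdec.
exact: LL.
Qed.
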